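(* Let $K_1\to K_2\to\dots\to K_n$ be a virtual isotopy sequence of single-component virtual diagrams (virtual knot diagrams) with classical initial and final diagrams. Suppose that the sequence fixes a base point and that, for a choice of orientation of the knot, for every classical crossing involved in a type v move the overcrossing is always encountered before the undercrossing when travelling along the knot from the base point following the orientation. Then the virtual isotopy sequence admits a valid virtual crossing realization.
   Context: A virtual link diagram is a finite collection of oriented closed curves generically immersed in the plane whose transverse double points are of two kinds: classical crossings (carrying over/under information) and virtual crossings (undecorated, drawn circled). A diagram is classical if it has no virtual crossings. The virtual moves are: the Reidemeister moves I, II, III on classical crossings; the moves vI, vII, vIII, which have the same underlying shape as I, II, III but with all crossings virtual; and the move v, a triangle move in which a strand with two consecutive virtual crossings is moved past a classical crossing. Triangle moves with two classical crossings and one virtual crossing (forbidden moves) are not allowed. A virtual isotopy sequence is a sequence of diagrams $K_1\to\dots\to K_n$ where each $K_i$ differs from $K_{i-1}$ by a single virtual move (and possibly a planar isotopy). Each crossing is named and followed through the sequence. A virtual crossing realization of the sequence is an assignment of a sign ($+$ or $-$) to each virtual crossing throughout the sequence, i.e. a replacement of each virtual crossing, throughout its lifetime in the sequence, by a classical crossing of the chosen sign. It is valid if the resulting sequence is a sequence of valid classical (Reidemeister) moves: every vII move becomes a II move and every v or vIII move becomes a III move. A move fixes a base point on the knot if the base point lies outside the part of the diagram pictured in the move (the disk in which the move takes place); a sequence fixes a base point if all its moves do. *)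

(* Defs.v *)
From mathcomp Require Import all_boot.

(******************************************************************************)
(* Oriented virtual knot diagrams, up to isotopy of the plane, are encoded by *)
(* the sequence of passes through (named) crossings met along the knot, read  *)
(* from an arbitrary starting point.  The two passes (c, true), (c, false)    *)
(* through c are told apart by the plane: the tangent vectors of (c, true)    *)
(* and (c, false), in this order, form a positively oriented frame.  Such a   *)
(* word determines the curve on the oriented sphere; the choice of one of its *)
(* faces as the outer one makes it a curve in the plane.                      *)
(******************************************************************************)

Definition pass : Type := (nat * bool)%type.

Definition gauss_word (w : seq pass) : Prop :=
  uniq w /\ forall p, p \in w -> (p.1, ~~ p.2) \in w.

(* Edge i arrives at letter i and leaves letter i - 1, cyclically.  The empty *)
(* word (the circle without crossings) has one edge.                          *)
Definition edge (w : seq pass) : Type := 'I_(size w).-1.+1.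

(* (e, true) is the left side of e, i.e. e travelled forwards with the face   *)
(* on the left; (e, false) is its right side, i.e. e travelled backwards.     *)
Definition side (w : seq pass) : Type := (edge w * bool)%type.

(* Follow the boundary of a face keeping it on the left: go to the end of the *)
(* edge and turn left.  Arriving forwards on (c, true), the strand (c, false) *)
(* crosses from right to left, so a left turn follows it forwards; each       *)
(* change of direction or of strand reverses this.                            *)
Definition face_next (w : seq pass) (a : side w) : side w :=
  if nilp w then a else
  let p := nth (0, false) w (if a.2 then a.1 else ord_pred a.1) in
  let k : edge w := inord (index (p.1, ~~ p.2) w) in
  if p.2 == a.2 then (ordS k, true) else (k, false).

(* Euler's formula: n crossings, 2n edges, n + 2 faces (also for n = 0).      *)
Definition planar (w : seq pass) : Prop :=
  fcard (face_next w) predT = (size w)./2 + 2.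

(* Classical true is a positive crossing, Classical false a negative one.  By *)
(* the choice of labels, (c, b) passes over c iff c is Classical b.           *)
Inductive crossing := Virtual | Classical of bool.

Definition is_virtual (x : crossing) : bool :=
  if x is Virtual then true else false.
Definition is_over (t : nat -> crossing) (p : pass) : bool :=
  if t p.1 is Classical s then p.2 == s else false.
Definition is_under (t : nat -> crossing) (p : pass) : bool :=
  if t p.1 is Classical s then p.2 != s else false.

(* outer_side is any side lying on the outer (unbounded) face; ctype is only  *)
(* meaningful on the crossings of the diagram.                                *)
Record diagram := Diagram {
  word : seq pass;
  ctype : nat -> crossing;
  outer_side : side word;
  word_gauss : gauss_word word;
  word_planar : planar word
}.

Definition crossings (D : diagram) : seq nat := undup (unzip1 (word D)).

Definition is_classical_diagram (D : diagram) : Prop :=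
  forall c, c \in crossings D -> ~~ is_virtual (ctype D c).

Definition on_outer_face (D : diagram) (a : side (word D)) : bool :=
  fconnect (face_next (word D)) (outer_side D) a.

(******************************************************************************)
(* Moves.  The disk of a move meets the knot in one, two or three strands.    *)
(******************************************************************************)

(* In Tangle2 c d b parallel, the first strand meets c, then d; it crosses    *)
(* the second strand in opposite directions at c and d.  In Tangle3, the      *)
(* strands A, B, C are met in the order A, B, C, or A, C, B if swapped.  They *)
(* bound a triangle that one runs around counterclockwise along A, B and C,   *)
(* turning left at x from A to B, at y from B to C and at z from C to A; the  *)
(* booleans a, b, c tell whether A, B, C are then followed forwards.          *)
Inductive tangle :=
  | Tangle1 (c : nat) (b : bool)
  | Tangle2 (c d : nat) (b parallel : bool)
  | Tangle3 (x y z : nat) (a b c swapped : bool).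

Definition triangle (x y z : nat) (a b c swapped : bool) : seq (seq pass) :=
  let orient (fwd : bool) (s : seq pass) := if fwd then s else rev s in
  let sA := orient a [:: (z, c != a); (x, a == b)] in
  let sB := orient b [:: (x, a != b); (y, b == c)] in
  let sC := orient c [:: (y, b != c); (z, c == a)] in
  if swapped then [:: sA; sC; sB] else [:: sA; sB; sC].

Definition full_strands (T : tangle) : seq (seq pass) :=
  match T with
  | Tangle1 c b => [:: [:: (c, b); (c, ~~ b)]]
  | Tangle2 c d b parallel =>
      let s := [:: (c, ~~ b); (d, b)] in
      [:: [:: (c, b); (d, ~~ b)]; if parallel then s else rev s]
  | Tangle3 x y z a b c swapped => triangle x y z a b c swapped
  end.

(* Moving a strand of a triangle across the opposite crossing reverses the    *)
(* order of the crossings along each strand.                                  *)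
Definition moved_strands (T : tangle) : seq (seq pass) :=
  match T with
  | Tangle1 _ _ => [:: [::]]
  | Tangle2 _ _ _ _ => [:: [::]; [::]]
  | Tangle3 x y z a b c swapped =>
      triangle x y z (~~ a) (~~ b) (~~ c) swapped
  end.

Definition tangle_crossings (T : tangle) : seq nat :=
  match T with
  | Tangle1 c _ => [:: c]
  | Tangle2 c d _ _ => [:: c; d]
  | Tangle3 x y z _ _ _ _ => [:: x; y; z]
  end.

(* The move goes from full_strands to moved_strands if mforward, and the      *)
(* other way round otherwise.  The i-th word of mexterior is the part of the  *)
(* knot between the i-th strand of the disk and the next one.  Reading the    *)
(* words of the two diagrams from the edges mcut_before and mcut_after, the   *)
(* first strand in the disk comes first.                                      *)
Record move := Move {
  mtangle : tangle;
  mforward : bool;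
  mexterior : seq (seq pass);
  mcut_before : nat;
  mcut_after : nat
}.

Definition strands_before (m : move) : seq (seq pass) :=
  if mforward m then full_strands (mtangle m) else moved_strands (mtangle m).
Definition strands_after (m : move) : seq (seq pass) :=
  if mforward m then moved_strands (mtangle m) else full_strands (mtangle m).

Definition glue (S U : seq (seq pass)) : seq pass :=
  flatten [seq su.1 ++ su.2 | su <- zip S U].

(* A piece of edge outside the disk is given by (i, j): it follows the first  *)
(* j letters of the i-th exterior word.                                       *)
Definition exterior_piece (m : move) (q : nat * nat) : bool :=
  (q.1 < size (mexterior m)) && (q.2 <= size (nth [::] (mexterior m) q.1)).

Definition piece_edge (w : seq pass) (S U : seq (seq pass)) (cut : nat)
    (q : nat * nat) : edge w :=
  let pos := size (glue (take q.1 S) (take q.1 U))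
             + size (nth [::] S q.1) + q.2 in
  inord ((cut + pos) %% (size w).-1.+1).

Definition edge_before (D : diagram) (m : move) (q : nat * nat) :
    edge (word D) :=
  piece_edge (word D) (strands_before m) (mexterior m) (mcut_before m) q.
Definition edge_after (D : diagram) (m : move) (q : nat * nat) :
    edge (word D) :=
  piece_edge (word D) (strands_after m) (mexterior m) (mcut_after m) q.

(* The underlying move of curves in the plane, with the names of crossings.   *)
(* The last condition says that the point at infinity lies outside the disk:  *)
(* some region of the exterior, adjacent to a side of some exterior piece of  *)
(* edge, lies in the outer face both before and after the move.               *)
Definition flat_move (D : diagram) (m : move) (D' : diagram) : Prop :=
  [/\ size (mexterior m) = size (strands_before m),
      mcut_before m < (size (word D)).-1.+1
        /\ rot (mcut_before m) (word D) = glue (strands_before m) (mexterior m),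
      mcut_after m < (size (word D')).-1.+1
        /\ rot (mcut_after m) (word D') = glue (strands_after m) (mexterior m),
      (forall c, c \in crossings D -> c \in crossings D' ->
         ctype D c = ctype D' c)
    & exists q : nat * nat, exists s : bool,
        [/\ exterior_piece m q,
            on_outer_face D (edge_before D m q, s)
          & on_outer_face D' (edge_after D' m q, s)]].

(* All the crossings of the tangle occur in the diagram on its full side.     *)
Definition move_ctype (D : diagram) (m : move) (D' : diagram) :
    nat -> crossing := if mforward m then ctype D else ctype D'.

Definition some_strand_over (t : nat -> crossing) (T : tangle) : bool :=
  has (all (is_over t)) (full_strands T).
Definition some_strand_under (t : nat -> crossing) (T : tangle) : bool :=
  has (all (is_under t)) (full_strands T).

(* Moves I, II and III.  In II one strand lies over the other; in III there   *)
(* are a top, a middle and a bottom strand.                                   *)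
Definition classical_rule (t : nat -> crossing) (T : tangle) : bool :=
  all (fun c => ~~ is_virtual (t c)) (tangle_crossings T) &&
  match T with
  | Tangle1 _ _ => true
  | _ => some_strand_over t T && some_strand_under t T
  end.

(* Moves vI, vII and vIII. *)
Definition virtual_rule (t : nat -> crossing) (T : tangle) : bool :=
  all (fun c => is_virtual (t c)) (tangle_crossings T).

(* Move v: two of the three crossings of the triangle are virtual; they are   *)
(* those of the strand opposite to the classical crossing.                    *)
Definition mixed_rule (t : nat -> crossing) (T : tangle) : bool :=
  match T with
  | Tangle3 x y z _ _ _ _ =>
      count (fun c => is_virtual (t c)) [:: x; y; z] == 2
  | _ => false
  end.

Definition reidemeister_move (D : diagram) (m : move) (D' : diagram) : Prop :=
  flat_move D m D' /\ classical_rule (move_ctype D m D') (mtangle m).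

Definition v_move (D : diagram) (m : move) (D' : diagram) : Prop :=
  flat_move D m D' /\ mixed_rule (move_ctype D m D') (mtangle m).

Definition all_virtual_move (D : diagram) (m : move) (D' : diagram) : Prop :=
  flat_move D m D' /\ virtual_rule (move_ctype D m D') (mtangle m).

Definition virtual_move (D : diagram) (m : move) (D' : diagram) : Prop :=
  [\/ reidemeister_move D m D', all_virtual_move D m D' | v_move D m D'].

(******************************************************************************)
(* Sequences K 1 -> ... -> K n; the i-th move M i goes from K i to K i.+1.    *)
(******************************************************************************)

Definition virtual_isotopy (n : nat) (K : nat -> diagram) (M : nat -> move) :
    Prop :=
  forall i, 0 < i < n -> virtual_move (K i) (M i) (K i.+1).

(* The base point lies on edge p i of K i, and on a piece of edge outside the *)
(* disk of each move.                                                         *)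
Definition fixes_base_point (n : nat) (K : nat -> diagram) (M : nat -> move)
    (p : forall i, edge (word (K i))) : Prop :=
  forall i, 0 < i < n -> exists2 q, exterior_piece (M i) q &
    edge_before (K i) (M i) q = p i /\ edge_after (K i.+1) (M i) q = p i.+1.

(* The passes met from a base point on e; o = false is the orientation        *)
(* opposite to that of the diagram.                                           *)
Definition travel (D : diagram) (e : edge (word D)) (o : bool) : seq pass :=
  let w := rot e (word D) in if o then w else rev w.

Definition over_before_under (D : diagram) (e : edge (word D)) (o : bool)
    (c : nat) : Prop :=
  if ctype D c is Classical s then
    index (c, s) (travel D e o) < index (c, ~~ s) (travel D e o)
  else False.

(* s i c is the sign (true for +) given to the virtual crossing c of K i; it  *)
(* is constant throughout the lifetime of c.                                  *)
Definition virtual_crossing_realization (n : nat) (K : nat -> diagram)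
    (s : nat -> nat -> bool) : Prop :=
  forall i, 0 < i < n -> forall c,
    c \in crossings (K i) -> c \in crossings (K i.+1) ->
    is_virtual (ctype (K i) c) -> s i c = s i.+1 c.

Definition realize (D : diagram) (s : nat -> bool) : diagram :=
  {| word := word D;
     ctype := fun c => if ctype D c is Virtual then Classical (s c)
                       else ctype D c;
     outer_side := outer_side D;
     word_gauss := word_gauss D;
     word_planar := word_planar D |}.

Definition valid_realization (n : nat) (K : nat -> diagram) (M : nat -> move)
    (s : nat -> nat -> bool) : Prop :=
  forall i, 0 < i < n ->
    reidemeister_move (realize (K i) (s i)) (M i) (realize (K i.+1) (s i.+1)).

(* Main.v *)
Require Import Defs.
From mathcomp Require Import all_boot.

(** The realization that works makes every virtual crossing descending: the
    strand through which the knot, followed from the base point, first visits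
    the crossing becomes the over strand.

    The choice is constant during the lifetime of a crossing.  The base point
    and the exterior of the disk do not change in a move, and a strand of the
    disk never visits the same crossing twice, except in a move I, where this
    crossing does not survive.  A triangle move only permutes the visits along
    one strand to different crossings, so that for each crossing the subword
    of its two visits is left alone (first_label_move).

    The choice turns every move with virtual crossings into a Reidemeister
    move.  In a move v the only crossing that was already classical is
    descending by hypothesis, so after realization all the crossings in the
    disk are descending.  The first strand of the disk met from the base point
    meets each of its crossings for the first time, and thus lies over the
    others; the last one meets them for the second time, and lies under the
    others.  For two or three strands this is what the moves II and III demand
    (descending_rule).  A move on classical crossings only is unaffected.

    Cutting the knot at the base point, on a piece of edge outside the disk,
    displays it as the concatenation of exterior pieces and strands of the
    disk (rot_piece_edge).  Everything else is combinatorics of such words. *)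

(** * First visits *)

Definition visits (c : nat) (w : seq pass) : seq pass :=
  [seq p <- w | p.1 == c].
Arguments visits : simpl never.

(** Also the sign to give to c for it to be descending along w, as the pass
    (c, b) is the over pass of a crossing Classical b. *)
Definition first_label (c : nat) (w : seq pass) : bool :=
  (head (c, true) (visits c w)).2.

Definition oriented (o : bool) (w : seq pass) : seq pass :=
  if o then w else rev w.

Definition partner (p : pass) : pass := (p.1, ~~ p.2).

Definition is_loop (T : tangle) : bool :=
  if T is Tangle1 _ _ then true else false.
Definition is_triangle (T : tangle) : bool :=
  if T is Tangle3 _ _ _ _ _ _ _ then true else false.

Lemma first_label_index c b w :
  index (c, b) w < index (c, ~~ b) w -> first_label c w = b.
Proof.
elim: w => [//|[d b'] w IH]; rewrite /first_label /visits /= !xpair_eqE.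
case: (d =P c) => [->|_] /=; last by rewrite ltnS => /IH.
by case: b b' {IH} => [] [].
Qed.

Lemma first_label_over X t Y p :
  p \in t -> partner p \notin X -> partner p \notin t ->
  first_label p.1 (X ++ t ++ Y) = p.2.
Proof.
case: p => c b /= pt oX ot; apply: first_label_index.
rewrite !index_cat pt (negbTE oX) (negbTE ot).
case: ifP => [pX|_]; last by rewrite ltn_add2l ltn_addr // index_mem.
by rewrite ltn_addr // index_mem.
Qed.

Lemma first_label_under X t Y p :
  p \notin X -> partner p \in X -> first_label p.1 (X ++ t ++ Y) = ~~ p.2.
Proof.
case: p => c b /= pX oX; apply: first_label_index.
by rewrite !index_cat negbK oX (negbTE pX) ltn_addr // index_mem.
Qed.

(** * The knot cut at a point outside the disk *)

(** The cyclic word glue S U, read from the point of the exterior piece q. *)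
Definition base_word (S U : seq (seq pass)) (q : nat * nat) : seq pass :=
  let u := nth [::] U q.1 in
  drop q.2 u ++ glue (drop q.1.+1 S) (drop q.1.+1 U)
  ++ glue (take q.1 S) (take q.1 U) ++ nth [::] S q.1 ++ take q.2 u.

Lemma glue_cat S S' U U' :
  size S = size U -> glue (S ++ S') (U ++ U') = glue S U ++ glue S' U'.
Proof. by move=> eqSU; rewrite /glue zip_cat // map_cat flatten_cat. Qed.

Lemma perm_glue S U :
  size U = size S -> perm_eq (glue S U) (flatten S ++ flatten U).
Proof.
elim: S U => [|s S IH] [|u U] //= [/IH/permP eqSU].
apply/permP => a; move/(_ a): eqSU; rewrite /glue /= !count_cat => ->.
exact: addnACA.
Qed.

Lemma glue_split S U q (u := nth [::] U q.1) :
  size U = size S -> q.1 < size U ->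
  glue S U =
  (glue (take q.1 S) (take q.1 U) ++ nth [::] S q.1 ++ take q.2 u)
  ++ drop q.2 u ++ glue (drop q.1.+1 S) (drop q.1.+1 U).
Proof.
rewrite /u; case: q {u} => i j /= eqSU ltiU.
transitivity (glue (take i S ++ drop i S) (take i U ++ drop i U)).
  by rewrite !cat_take_drop.
rewrite glue_cat; last by rewrite !size_take eqSU.
rewrite (drop_nth [::] ltiU) (drop_nth [::] (s := S)) -?eqSU //.
by rewrite {2}/glue /= -!catA (catA (take j _)) cat_take_drop.
Qed.

Lemma base_word_rot S U q :
  size U = size S -> q.1 < size U -> q.2 <= size (nth [::] U q.1) ->
  base_word S U q =
  rot (size (glue (take q.1 S) (take q.1 U)) + size (nth [::] S q.1) + q.2)
      (glue S U).
Proof.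
move=> eqSU ltq1 leq2; rewrite (glue_split _ _ _ eqSU ltq1).
set P := _ ++ _ ++ take _ _.
have <- : size P = size (glue (take q.1 S) (take q.1 U))
    + size (nth [::] S q.1) + q.2.
  by rewrite /P !size_cat size_takel // addnA.
by rewrite rot_size_cat /base_word /P -!catA.
Qed.

(** Cutting after the last letter is cutting before the first one, whence the
    reduction modulo the number of edges; a word without letters still has an
    edge. *)
Lemma rot_mod k cut (w : seq pass) :
  k <= size w -> cut < (size w).-1.+1 ->
  rot ((cut + k) %% (size w).-1.+1) w = rot k (rot cut w).
Proof.
case: (posnP (size w)) => [/size0nil -> //|w_gt0]; rewrite prednK // => lek ltcut.
rewrite rot_add_mod // ?(ltnW ltcut) // addnC.
case: ltngtP => [lt|gt|->]; first by rewrite modn_small.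
  rewrite -{1}(subnK (ltnW gt)) modnDr modn_small //.
  by rewrite ltn_subLR ?(ltnW gt) // -addnS addnC leq_add.
by rewrite modnn rot0 rot_size.
Qed.

Lemma rot_piece_edge w S U cut q :
  size U = size S -> cut < (size w).-1.+1 -> rot cut w = glue S U ->
  q.1 < size U -> q.2 <= size (nth [::] U q.1) ->
  rot (piece_edge w S U cut q) w = base_word S U q.
Proof.
move=> eqSU ltcut rotw ltq1 leq2.
rewrite base_word_rot // -rotw /piece_edge inordK ?ltn_pmod //.
apply: rot_mod => //; rewrite -(size_rot cut w) rotw (glue_split _ _ _ eqSU ltq1).
by rewrite !size_cat size_takel // !addnA -[leqRHS]addnA leq_addr.
Qed.

(** The base point may split an exterior piece but never a strand, so it is
    enough to compare the strands one by one. *)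
Lemma visits_base_word c S S' U q :
  map (visits c) S = map (visits c) S' ->
  visits c (base_word S U q) = visits c (base_word S' U q).
Proof.
have visits_glue A A' B : map (visits c) A = map (visits c) A' ->
    visits c (glue A B) = visits c (glue A' B).
  elim: A A' B => [|s A IH] [|s' A'] [|u B] //= [eqs eqA].
  by rewrite /glue /= /visits !filter_cat -!/(visits c _) eqs (IH A').
have visits_nth A : visits c (nth [::] A q.1) = nth [::] (map (visits c) A) q.1.
  by elim: A q.1 => [|s A IH] [|i] //=.
move=> eqS; rewrite /base_word /visits !filter_cat -!/(visits c _).
rewrite !visits_nth eqS (visits_glue (drop q.1.+1 S) (drop q.1.+1 S')).
  by rewrite (visits_glue (take q.1 S) (take q.1 S')) // !map_take eqS.
by rewrite !map_drop eqS.
Qed.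

(** * Strands of the disk *)

(** A crossing has two passes, while a coincidence among the corners would
    give it four passes with only two labels. *)
Lemma triangle_uniq x y z a b c sw :
  uniq (flatten (triangle x y z a b c sw)) -> [&& x != y, y != z & x != z].
Proof.
case: (x =P y) => [->|/eqP xy]; last case: (y =P z) => [->|/eqP yz];
  last case: (x =P z) => [->|//];
  by case: a b c sw => [] [] [] []; rewrite /= !inE !xpair_eqE !eqxx /= ?orbT ?andbF.
Qed.

Lemma moved_triangle x y z a b c sw :
  triangle x y z (~~ a) (~~ b) (~~ c) sw = map rev (triangle x y z a b c sw).
Proof. by case: a b c sw => [] [] [] []. Qed.

(** The strands of a triangle are reversed, but each of them visits a given
    crossing at most once. *)
Lemma visits_moved T c :
  uniq (flatten (full_strands T)) ->
  is_triangle T || (c \notin tangle_crossings T) ->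
  map (visits c) (full_strands T) = map (visits c) (moved_strands T).
Proof.
case: T => [d b|d e b par|x y z a b e sw]; rewrite /= ?inE ?negb_or.
- by move=> _ /negbTE cd; rewrite /visits /= !(eq_sym d) cd.
- move=> _ /andP[/negbTE cd /negbTE ce].
  by case: par; rewrite /visits /= !(eq_sym d, eq_sym e) cd ce.
move=> /triangle_uniq/and3P[/negbTE xy /negbTE yz /negbTE xz] _.
rewrite moved_triangle -map_comp; apply/eq_in_map.
have two p r : p.1 != r.1 -> visits c [:: p; r] = visits c [:: r; p].
  move=> pr; rewrite /visits /=.
  by case: eqP => [pc|_]; case: eqP => [rc|_] //=; rewrite pc rc eqxx in pr.
by move=> s; case: a b e sw => [] [] [] []; rewrite !inE => /or3P[]/eqP->;
  rewrite /rev /= two //= eq_sym ?xy ?yz ?xz //= eq_sym ?xy ?yz ?xz.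
Qed.

(** Without a loop, each crossing of the disk lies on two different strands. *)
Lemma partner_strand T t p :
  ~~ is_loop T ->
  uniq (flatten (full_strands T)) -> t \in full_strands T -> p \in t ->
  partner p \in flatten (full_strands T) /\ partner p \notin t.
Proof.
case: T => [//|d e b par|x y z a b e sw] _ U.
  have {}U : d != e.
    by move: U; case: eqP => [->|//]; case: b par => [] []; rewrite /= !inE !xpair_eqE !eqxx.
  by case: b par => [] []; rewrite /rev /= !inE => /orP[]/eqP->; rewrite !inE;
    move=> /orP[]/eqP->; rewrite /partner ?inE !xpair_eqE /= ?eqxx;
    rewrite ?(eq_sym e d) ?(negbTE U) /= ?orbT.
have /and3P[/negbTE xy /negbTE yz /negbTE xz] := triangle_uniq _ _ _ _ _ _ _ U.
by case: a b e sw {U} => [] [] [] [];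
  rewrite /triangle /rev /= !inE => /or3P[]/eqP->; rewrite !inE => /orP[]/eqP->;
  rewrite /partner ?inE !xpair_eqE /= ?eqxx ?(eq_sym y x) ?(eq_sym z x);
  rewrite ?(eq_sym z y) ?xy ?yz ?xz /= ?orbT.
Qed.

(** The reading direction is only a choice of the knot's orientation: the
    strand that lies over the others for one is under them for the other. *)
Lemma first_label_outermost X s Y p :
  uniq (X ++ s ++ Y) -> p \in s -> partner p \in X ++ s ++ Y ->
  partner p \notin X -> partner p \notin s ->
  first_label p.1 (X ++ s ++ Y) = p.2
  /\ first_label p.1 (rev (X ++ s ++ Y)) = ~~ p.2.
Proof.
rewrite !mem_cat => U ps oW oX os; split; first exact: first_label_over.
rewrite (negbTE oX) (negbTE os) /= in oW.
rewrite !rev_cat -catA; apply: first_label_under; rewrite mem_rev //.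
move: U; rewrite catA cat_uniq => /and3P[_ /hasPn/(_ p) notin _].
by apply/negP => /notin; rewrite mem_cat ps orbT.
Qed.

(** The next strand need not be the successor of strand q.1 in S, as the
    reading may pass the end of the cyclic word; if there is only one strand,
    it is q.1 itself. *)
Lemma strand_after_base S U q :
  size U = size S -> q.1 < size U ->
  exists2 s, s \in S & exists Y,
    base_word S U q = drop q.2 (nth [::] U q.1) ++ s ++ Y.
Proof.
move=> eqSU ltq; rewrite /base_word; set u := nth _ _ _.
have : size (drop q.1.+1 S) = size (drop q.1.+1 U) by rewrite !size_drop eqSU.
have : size (take q.1 S) = size (take q.1 U) by rewrite !size_take eqSU.
have dS s : s \in drop q.1.+1 S -> s \in S := @mem_drop _ _ _ _.
have tS s : s \in take q.1 S -> s \in S := @mem_take _ _ _ _.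
case: (drop _ S) (drop _ U) dS => [|s S1] [|u1 U1] // dS; last first.
  move=> _ _; exists s; first by rewrite dS ?mem_head.
  by rewrite /glue /= -!catA; eexists.
case: (take _ S) (take _ U) tS => [|s S1] [|u1 U1] // tS; last first.
  move=> _ _; exists s; first by rewrite tS ?mem_head.
  by rewrite /glue /= -!catA; eexists.
move=> _ _; exists (nth [::] S q.1); first by rewrite mem_nth -?eqSU.
by eexists.
Qed.

Lemma strand_names T p :
  p \in flatten (full_strands T) -> p.1 \in tangle_crossings T.
Proof.
have sub (s : seq pass) (cs : seq nat) :
    all (fun p => p.1 \in cs) s -> p \in s -> p.1 \in cs.
  by move=> /allP/(_ p).
apply: sub; case: T => [d b|d e b par|x y z a b e sw] /=.
- by rewrite !inE eqxx.
- by case: par; rewrite /= !inE !eqxx ?orbT.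
by case: a b e sw => [] [] [] []; rewrite /= !inE !eqxx ?orbT.
Qed.

Lemma tangle_names T c :
  c \in tangle_crossings T -> exists b, (c, b) \in flatten (full_strands T).
Proof.
case: T => [d b|d e b par|x y z a b e sw] /=; rewrite !inE.
- by move/eqP->; exists b; rewrite inE eqxx.
- by case/orP=> /eqP->; [exists b|exists (~~ b)]; rewrite !inE eqxx ?orbT.
case/or3P => /eqP->; [exists (a == b)|exists (b == e)|exists (e == a)];
  by case: a b e sw => [] [] [] []; rewrite /= !inE !eqxx ?orbT.
Qed.

(** * Descending disks satisfy the Reidemeister rules *)

(** If the knot is followed forwards, the strand after the base point is on
    top and strand q.1, the last one met, is at the bottom; backwards, they
    exchange their roles. *)
Lemma descending_rule t T U q o (W := base_word (full_strands T) U q) :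
  size U = size (full_strands T) -> q.1 < size U -> uniq W ->
  perm_eq W (flatten (full_strands T) ++ flatten U) ->
  {in tangle_crossings T,
    forall c, t c = Classical (first_label c (oriented o W))} ->
  classical_rule t T.
Proof.
move=> eqSU ltq uW permW tE; apply/andP; split.
  by apply/allP => c /tE ->.
have [|notloop] := boolP (is_loop T); first by case: T {eqSU permW tE W uW}.
suff : some_strand_over t T && some_strand_under t T.
  by case: T {eqSU permW tE W uW notloop}.
have : uniq (flatten (full_strands T) ++ flatten U) by rewrite -(perm_uniq permW).
rewrite cat_uniq => /and3P[uS /hasPn disj _].
have oppU s p : s \in full_strands T -> p \in s ->
    [/\ partner p \in W, partner p \notin flatten U, partner p \notin s
      & p.1 \in tangle_crossings T].
  move=> sS ps; have [oS os] := partner_strand _ _ _ notloop uS sS ps.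
  split=> //; first by rewrite (perm_mem permW) mem_cat oS.
    by apply/negP => /disj; rewrite oS.
  by apply: strand_names; apply/flattenP; exists s.
have nthU : {subset nth [::] U q.1 <= flatten U}.
  by move=> p pu; apply/flattenP; exists (nth [::] U q.1); rewrite // mem_nth.
have [s sS [Y WE]] := strand_after_base _ _ _ eqSU ltq.
have firstE p : p \in s ->
    first_label p.1 W = p.2 /\ first_label p.1 (rev W) = ~~ p.2.
  move=> ps; have [oW oU os _] := oppU _ _ sS ps.
  rewrite /W WE; apply: first_label_outermost; rewrite -?WE //.
  by apply: contra oU => /mem_drop/nthU.
pose s' := nth [::] (full_strands T) q.1.
have s'S : s' \in full_strands T by rewrite mem_nth -?eqSU.
have lastE p : p \in s' ->
    first_label p.1 (rev W) = p.2 /\ first_label p.1 W = ~~ p.2.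
  move=> ps; have [oW oU os _] := oppU _ _ s'S ps.
  have [X WX] : exists X, rev W = rev (take q.2 (nth [::] U q.1)) ++ rev s' ++ X.
    by rewrite /W /base_word !rev_cat -!catA; eexists.
  rewrite -{2}(revK W) WX; apply: first_label_outermost;
    rewrite -?WX ?rev_uniq ?mem_rev //.
  by apply: contra oU => /mem_take/nthU.
case: o tE => tE; apply/andP; split; apply/hasP.
- exists s => //; apply/allP => p ps; have [_ _ _ /tE pE] := oppU _ _ sS ps.
  by rewrite /is_over pE; case: (firstE p ps) => -> _; rewrite eqxx.
- exists s' => //; apply/allP => p ps; have [_ _ _ /tE pE] := oppU _ _ s'S ps.
  by rewrite /is_under pE; case: (lastE p ps) => _ ->; case: p.2.
- exists s' => //; apply/allP => p ps; have [_ _ _ /tE pE] := oppU _ _ s'S ps.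
  by rewrite /is_over pE; case: (lastE p ps) => -> _; rewrite eqxx.
exists s => //; apply/allP => p ps; have [_ _ _ /tE pE] := oppU _ _ sS ps.
by rewrite /is_under pE; case: (firstE p ps) => _ ->; case: p.2.
Qed.

Lemma eq_classical_rule t t' T :
  {in tangle_crossings T, t =1 t'} -> classical_rule t T -> classical_rule t' T.
Proof.
move=> tt'.
have nv : all (fun c => ~~ is_virtual (t c)) (tangle_crossings T)
        = all (fun c => ~~ is_virtual (t' c)) (tangle_crossings T).
  by apply: eq_in_all => c /tt' ->.
have over : some_strand_over t T = some_strand_over t' T.
  apply: eq_in_has => s sS; apply: eq_in_all => p ps; rewrite /is_over tt' //.
  by apply: strand_names; apply/flattenP; exists s.
have under : some_strand_under t T = some_strand_under t' T.
  apply: eq_in_has => s sS; apply: eq_in_all => p ps; rewrite /is_under tt' //.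
  by apply: strand_names; apply/flattenP; exists s.
by rewrite /classical_rule nv over under.
Qed.

(** * Effect of a move on the word of the knot *)

Lemma gauss_crossing w c b b' : gauss_word w -> (c, b) \in w -> (c, b') \in w.
Proof.
move=> [_ wopp] cw; case: (b' =P b) => [-> //|]; move: (wopp _ cw) => /=.
by case: b b' {cw} => [] [].
Qed.

Lemma crossing_pass D c b : (c \in crossings D) = ((c, b) \in word D).
Proof.
rewrite /crossings mem_undup; apply/mapP/idP => [[[d b'] dw /= ->]|cw].
  exact: gauss_crossing (word_gauss D) dw.
by exists (c, b).
Qed.

Lemma size_strands m : size (strands_after m) = size (strands_before m).
Proof.
rewrite /strands_before /strands_after.
by case: (mforward m); case: (mtangle m) => // x y z a b c [].
Qed.

Lemma perm_word_before D m D' : flat_move D m D' ->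
  perm_eq (word D) (flatten (strands_before m) ++ flatten (mexterior m)).
Proof.
case=> eqS [_ rotD] _ _ _.
by rewrite -(permPr (perm_glue _ _ eqS)) -rotD perm_sym perm_rot.
Qed.

Lemma perm_word_after D m D' : flat_move D m D' ->
  perm_eq (word D') (flatten (strands_after m) ++ flatten (mexterior m)).
Proof.
case=> eqS _ [_ rotD'] _ _.
by rewrite -(permPr (perm_glue _ _ (etrans eqS (esym (size_strands m)))))
  -rotD' perm_sym perm_rot.
Qed.

(** The crossings of a move I or II occur on one side only: on the other side
    they could only be visited in the exterior, where the uniqueness of the
    passes on the full side forbids it. *)
Lemma visits_strands D m D' c :
  flat_move D m D' -> c \in crossings D -> c \in crossings D' ->
  map (visits c) (strands_before m) = map (visits c) (strands_after m).
Proof.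
move=> DD' cD cD'.
suff H (E E' : diagram) : c \in crossings E' ->
    perm_eq (word E) (flatten (full_strands (mtangle m)) ++ flatten (mexterior m)) ->
    perm_eq (word E') (flatten (moved_strands (mtangle m)) ++ flatten (mexterior m)) ->
    map (visits c) (full_strands (mtangle m))
    = map (visits c) (moved_strands (mtangle m)).
  have := perm_word_before _ _ _ DD'; have := perm_word_after _ _ _ DD'.
  rewrite /strands_before /strands_after.
  by case: (mforward m) => permD' permD; [apply: (H D D')|rewrite (H D' D)].
move=> cE' permE permE'.
have : uniq (word E) by case: (word_gauss E).
rewrite (perm_uniq permE) cat_uniq => /and3P[uS /hasPn disj _].
apply: visits_moved => //; have [//|nm3] := boolP (is_triangle (mtangle m)).
have moved0 : flatten (moved_strands (mtangle m)) = [::].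
  by case: (mtangle m) nm3.
apply/negP => /tangle_names[b cS].
have /disj/negP[//] : (c, b) \in flatten (mexterior m).
by rewrite (crossing_pass _ _ b) (perm_mem permE') moved0 in cE'.
Qed.

Lemma travel_before D m D' q o : flat_move D m D' -> exterior_piece m q ->
  travel D (edge_before D m q) o =
  oriented o (base_word (strands_before m) (mexterior m) q).
Proof.
case=> eqS [ltcut rotD] _ _ _ /andP[ltq leq2].
by rewrite /travel /edge_before (rot_piece_edge _ _ _ _ _ eqS).
Qed.

Lemma travel_after D m D' q o : flat_move D m D' -> exterior_piece m q ->
  travel D' (edge_after D' m q) o =
  oriented o (base_word (strands_after m) (mexterior m) q).
Proof.
case=> eqS _ [ltcut rotD'] _ _ /andP[ltq leq2].
by rewrite /travel /edge_after
  (rot_piece_edge _ _ _ _ _ (etrans eqS (esym (size_strands m)))).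
Qed.

Lemma first_label_move D m D' q o c :
  flat_move D m D' -> exterior_piece m q ->
  c \in crossings D -> c \in crossings D' ->
  first_label c (travel D (edge_before D m q) o)
  = first_label c (travel D' (edge_after D' m q) o).
Proof.
move=> DD' extq cD cD'.
rewrite (travel_before _ _ _ _ _ DD') // (travel_after _ _ _ _ _ DD') //.
have /visits_base_word eqW := visits_strands _ _ _ _ DD' cD cD'.
by case: o; rewrite /oriented /first_label /visits ?filter_rev -!/(visits _ _) eqW.
Qed.

(** * The descending realization *)

Definition descending (D : diagram) (e : edge (word D)) (o : bool) : diagram :=
  realize D (fun c => first_label c (travel D e o)).

Lemma triangle_crossings D m D' c : flat_move D m D' ->
  is_triangle (mtangle m) ->
  c \in tangle_crossings (mtangle m) -> c \in crossings D /\ c \in crossings D'.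
Proof.
move=> DD' m3 /tangle_names[b cS].
have cM : (c, b) \in flatten (moved_strands (mtangle m)).
  case: (mtangle m) m3 cS => // x y z a1 a2 a3 sw _.
  by rewrite /= moved_triangle => /flattenP[s sS cs]; apply/flattenP;
    exists (rev s); rewrite ?map_f ?mem_rev.
rewrite !(crossing_pass _ c b) (perm_mem (perm_word_before _ _ _ DD')).
rewrite (perm_mem (perm_word_after _ _ _ DD')) !mem_cat.
by rewrite /strands_before /strands_after; case: (mforward m); rewrite cS cM.
Qed.

(** If the rule of the move already holds, all its crossings are classical and
    nothing changes.  Otherwise every crossing of the disk is descending on the
    full side of the move.  For the classical crossing of a move v, known to be
    descending on the side before the move, this uses that it survives. *)
Lemma descending_move D m D' q o :
  virtual_move D m D' -> exterior_piece m q ->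
  (v_move D m D' -> forall c, c \in tangle_crossings (mtangle m) ->
     ~~ is_virtual (ctype D c) ->
     over_before_under D (edge_before D m q) o c) ->
  reidemeister_move (descending D (edge_before D m q) o) m
    (descending D' (edge_after D' m q) o).
Proof.
move=> mv extq ovun.
have DD' : flat_move D m D' by case: mv => [][].
have labelE := first_label_move _ _ _ _ o _ DD' extq.
split.
  case: DD' => eqS rotD rotD' ctypeE outer; split=> // c cD cD' /=.
  by rewrite ctypeE // (labelE c).
(* The journey along the knot on the full side of the move. *)
pose F := if mforward m then travel D (edge_before D m q) o
          else travel D' (edge_after D' m q) o.
pose t := move_ctype D m D'.
pose t' := move_ctype (descending D (edge_before D m q) o) m
             (descending D' (edge_after D' m q) o).
have t'E c : t' c = if t c is Virtual then Classical (first_label c F) else t c.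
  by rewrite /t' /t /F /move_ctype; case: (mforward m).
have nvE c : ~~ is_virtual (t c) -> t' c = t c by rewrite t'E; case: (t c).
have vE c : is_virtual (t c) -> t' c = Classical (first_label c F).
  by rewrite t'E; case: (t c).
suff desc : ~~ classical_rule t (mtangle m) ->
    {in tangle_crossings (mtangle m), forall c,
      t' c = Classical (first_label c F)}.
  have [rule|ruleN] := boolP (classical_rule t (mtangle m)).
    apply: eq_classical_rule (rule) => c cT; symmetry; apply: nvE.
    by move: rule => /andP[/allP/(_ _ cT)].
  have eqS : size (mexterior m) = size (full_strands (mtangle m)).
    case: DD' => -> _ _ _ _; rewrite /strands_before.
    by case: (mforward m); case: (mtangle m) => // x y z a b c [].
  have [ltq leq2] := andP extq.
  pose W := base_word (full_strands (mtangle m)) (mexterior m) q.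
  have FE : F = oriented o W.
    rewrite /F (travel_before _ _ _ _ _ DD') // (travel_after _ _ _ _ _ DD') //.
    by rewrite /strands_before /strands_after; case: (mforward m).
  have permW : perm_eq W
      (flatten (full_strands (mtangle m)) ++ flatten (mexterior m)).
    by rewrite /W base_word_rot // perm_rot perm_glue.
  have uW : uniq W.
    have uD (E : diagram) : uniq (word E) by case: (word_gauss E).
    rewrite (perm_uniq permW).
    have := perm_uniq (perm_word_before _ _ _ DD').
    have := perm_uniq (perm_word_after _ _ _ DD').
    rewrite /strands_before /strands_after !uD.
    by case: (mforward m) => [_ <-|<- _].
  apply: (descending_rule _ _ _ _ o eqS ltq uW permW) => c cT.
  by move: (desc ruleN c cT); rewrite FE.
case: mv => [[_ rule]|[_ /allP rule] _ c /rule/vE //|[vm rule] _ c cT].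
  by rewrite /t rule.
have [/vE //|ncl] := boolP (is_virtual (t c)).
have m3 : is_triangle (mtangle m).
  by case: (mtangle m) rule.
have [cD cD'] := triangle_crossings _ _ _ _ DD' m3 cT.
have tD : t c = ctype D c.
  rewrite /t /move_ctype; case: (mforward m) => //.
  by case: DD' => _ _ _ -> .
have FD : first_label c F = first_label c (travel D (edge_before D m q) o).
  by rewrite /F; case: (mforward m) => //; rewrite -labelE.
have := ovun (conj vm rule) c cT; rewrite -tD ncl => /(_ isT).
rewrite (nvE _ ncl) FD /over_before_under -tD.
by case: (t c) => // b /first_label_index ->.
Qed.

Theorem theorem2 (n : nat) (K : nat -> diagram) (M : nat -> move)
    (p : forall i, edge (word (K i))) (o : bool) :
  0 < n ->
  virtual_isotopy n K M ->
  is_classical_diagram (K 1) ->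
  is_classical_diagram (K n) ->
  fixes_base_point n K M p ->
  (forall i, 0 < i < n -> v_move (K i) (M i) (K i.+1) ->
     forall c, c \in tangle_crossings (mtangle (M i)) ->
       ~~ is_virtual (ctype (K i) c) ->
       over_before_under (K i) (p i) o c) ->
  exists s : nat -> nat -> bool,
    virtual_crossing_realization n K s /\ valid_realization n K M s.
Proof.
move=> _ isotopy _ _ base ovun.
exists (fun i c => first_label c (travel (K i) (p i) o)); split=> i lt_in.
  move=> c cK cK' _; have [q extq [<- <-]] := base i lt_in.
  by apply: first_label_move => //; case: (isotopy i lt_in) => [][].
have [q extq [pE p'E]] := base i lt_in.
move: (ovun i lt_in); rewrite -pE -p'E => ovun_i.
by apply: descending_move; first exact: isotopy.
Qed.
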